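(* Let $X$ be a set, let $m,n\ge 2$ be integers, let $f\in\Omega_m(X)$, and let $\varphi(x_1,\ldots,x_t)$ and $\psi(x_1,\ldots,x_t)$ be two algebraic terms in the variables $x_1,\ldots,x_t$ built using a single $m$-ary product. Then the $m$-ary groupoid $(X,f)$ satisfies the algebraic identity $\varphi=\psi$ if and only if the $m$-ary groupoid $(\Omega_n(X),\odot_f)$ satisfies it.
   Context: For a set $Y$, $\Omega_m(Y)$ is the set of all $m$-ary operations $Y^m\to Y$; an $m$-ary groupoid is a pair $(Y,F)$ with $F\in\Omega_m(Y)$. For $f\in\Omega_m(X)$, the $m$-ary operation $\odot_f$ on the set $\Omega_n(X)$ is defined by $\odot_f(g_1,\ldots,g_m)(\overline a):=f(g_1(\overline a),\ldots,g_m(\overline a))$ for all $g_1,\ldots,g_m\in\Omega_n(X)$ and $\overline a\in X^n$. Terms are formed from the variables $x_1,\ldots,x_t$ by repeated application of one formal $m$-ary product symbol. An $m$-ary groupoid $(Y,F)$ satisfies the identity $\varphi=\psi$ if, interpreting every product in both terms as $F$, $\varphi(y_1,\ldots,y_t)=\psi(y_1,\ldots,y_t)$ for all $y_1,\ldots,y_t\in Y$. *)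

(* Defs.v *)
From mathcomp Require Import all_boot.

Set Implicit Arguments.
Unset Strict Implicit.
Unset Printing Implicit Defensive.

(* The m-ary operations on Y; [Y ^ m] is [{ffun 'I_m -> Y}], the set of m-tuples. *)
Definition Omega (m : nat) (Y : Type) : Type := (Y ^ m)%type -> Y.

Definition odot (m n : nat) (X : Type) (f : Omega m X) : Omega m (Omega n X) :=
  fun g => fun a : (X ^ n)%type => f [ffun i => g i a].

(* Terms in the variables x_1, ..., x_t, which are indexed by ['I_t]. *)
Inductive term (m t : nat) : Type :=
| Var of 'I_t
| Prod of (term m t ^ m)%type.

Fixpoint eval (m t : nat) (Y : Type) (F : Omega m Y) (y : (Y ^ t)%type)
    (phi : term m t) : Y :=
  match phi with
  | Var i => y i
  | Prod s => F [ffun i => eval F y (s i)]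
  end.

Definition satisfies (m t : nat) (Y : Type) (F : Omega m Y)
    (phi psi : term m t) : Prop :=
  forall y : (Y ^ t)%type, eval F y phi = eval F y psi.

(* Main.v *)
(* Evaluation at a point a of X^n is a homomorphism from Omega_n(X) to X, so
   identities pass pointwise to Omega_n(X); conversely the constant operations
   form a copy of X inside Omega_n(X).  Recovering X from that copy needs a point
   of X^n, and since m > 0 every term contains a variable, whose value gives one. *)
From Stdlib Require Import FunctionalExtensionality.
Require Import Defs.
From mathcomp Require Import all_boot.

(* The automatically generated principle has no hypothesis for the subterms [s i]. *)
Lemma nested_term_ind (m t : nat) (P : term m t -> Prop) :
  (forall i, P (Var m i)) ->
  (forall s : (term m t ^ m)%type, (forall i, P (s i)) -> P (Prod s)) ->
  forall phi, P phi.
Proof.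
(* The recursion is well-founded because the guard condition accepts [s i] as a structural subterm
   of [Prod s]. *)
move=> PVar PProd; fix IH 1; case=> [i|s]; first exact: PVar.
by apply: PProd => i; apply: IH.
Qed.

Lemma eval_odot (X : Type) (m n t : nat) (f : Omega m X)
    (g : (Omega n X ^ t)%type) (phi : term m t) (a : (X ^ n)%type) :
  eval (odot (n := n) f) g phi a = eval f [ffun i => g i a] phi.
Proof.
elim/nested_term_ind: phi => [i|s IH] /=; first by rewrite ffunE.
by rewrite /odot; congr f; apply/ffunP => i; rewrite !ffunE.
Qed.

(** Descending into argument [0] of each product ends at a variable. *)
Lemma term_has_var (m t : nat) (phi : term m t) : 0 < m -> inhabited 'I_t.
Proof.
move=> m_gt0; elim/nested_term_ind: phi => [i|s IH]; first exact: inhabits i.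
exact: IH (Ordinal m_gt0).
Qed.

Theorem lemma3p2 (X : Type) (m n : nat) (hm : 2 <= m) (hn : 2 <= n)
    (f : Omega m X) (t : nat) (phi psi : term m t) :
  satisfies f phi psi <-> satisfies (odot (n := n) f) phi psi.
Proof.
split=> [sat g|sat y].
  (* Elements of [Omega n X] are plain functions, so their equality needs the extensionality
     axiom. *)
  by apply: functional_extensionality => a; rewrite !eval_odot.
have [i0] := term_has_var m t phi (ltnW hm).
(* The variables take the constant operations with values [y i]; the constant tuple at [y i0] is
   merely some point at which to evaluate them, giving back [y]. *)
have := congr1 (fun h : Omega n X => h [ffun=> y i0])
               (sat [ffun i => (fun=> y i) : Omega n X]).
rewrite !eval_odot.
suff -> : [ffun i => [ffun i => (fun=> y i) : Omega n X] i [ffun=> y i0]] = y by [].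
by apply/ffunP => i; rewrite !ffunE.
Qed.
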